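(* Let $\mathcal{M}$ be a set of monitored entries of $\Sigma$, and assume: (A1) attacks are collective Gaussian attacks; (A2) by Gaussian extremality $\Sigma$ is a sufficient statistic; (A3) the shot-noise unit is trusted, so that the observed covariance equals the true $\Sigma(T,\xi)$, and the map $(T,\xi)\mapsto\Sigma(T,\xi)$ is a homeomorphism from $\mathcal{D}$ onto its image. Then on the interval $\chi_0\in(\chi_{\mathrm{ben}},\chi_{\max}^{\mathcal M})$: (i) $g_{\mathcal M}$ is nondecreasing in $\chi_0$; (ii) $g_{\mathcal M}(\chi_0)>0$; (iii) in the trusted-correlation model, $g_{\mathcal M}$ is strictly increasing; (iv) for general $\mathcal{M}$ such that $p_0$ is the only local minimizer of $D(p):=D(\Sigma_0\Vert\Sigma(p))$ on $\mathcal{F}_{\mathcal M}$, $g_{\mathcal M}$ is strictly increasing. In cases (iii) and (iv), $g_{\mathcal M}^{-1}$ is single-valued on the corresponding range. If instead the shot-noise unit is untrusted (that is, one drops the assumption that the shot-noise unit is trusted, so that the observed covariance equals the true $\Sigma(T,\xi)$, and that the map $(T,\xi)\mapsto\Sigma(T,\xi)$ is a homeomorphism from $\mathcal{D}$ onto its image), then $g_{\mathcal M}\equiv 0$.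
   Context: Fixed constants: modulation variance $V_A>0$, $V=V_A+1$, detector efficiency $\eta\in(0,1]$, electronic noise $v_{\mathrm{el}}\ge0$ (shot-noise units, vacuum variance $1$). The parameters $p=(T,\xi)$ (transmittance, excess noise) range over the compact domain $\mathcal{D}=[T_{\min},1]\times[0,\xi_{\max}]$ with $0<T_{\min}\le T_0$, $\xi_{\max}<\infty$; the benign point is $p_0=(T_0,\xi_0)\in\mathcal{D}$. Define $$\Sigma(T,\xi)=\begin{pmatrix}V_A&\sqrt{\eta T}\,V_A\\ \sqrt{\eta T}\,V_A&\eta T V_A+N(T,\xi)\end{pmatrix},\qquad N(T,\xi)=1+v_{\mathrm{el}}+\eta T\xi,$$ and $\Sigma_0=\Sigma(p_0)$. For positive definite $2\times2$ matrices, $D(\Sigma_0\Vert\Sigma_1)=\tfrac12[\operatorname{tr}(\Sigma_1^{-1}\Sigma_0)-2+\ln(\det\Sigma_1/\det\Sigma_0)]$ (the relative entropy of the centered Gaussians). Holevo bound $\chi_{BE}(T,\xi)$ (collective attacks, reverse reconciliation), which is continuous on $\mathcal D$: let $\rho_{AB}(T,\xi)$ be the zero-mean two-mode Gaussian state with quadrature covariance matrix $\begin{pmatrix}V\mathbb 1_2&\sqrt{T(V^2-1)}\,\sigma_z\\ \sqrt{T(V^2-1)}\,\sigma_z&b\,\mathbb 1_2\end{pmatrix}$, $b=T(V_A+\xi)+1$, $\sigma_z=\mathrm{diag}(1,-1)$ (vacuum has covariance $\mathbb 1$). Let $E$ purify $\rho_{AB}$, and let $y$ be the outcome of Bob's trusted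 detection of $B$: homodyne of one quadrature after a beam splitter of transmissivity $\eta$ with electronic noise $v_{\mathrm{el}}$, i.e. $y=\sqrt\eta\,q_B+w$ with $w$ independent centered Gaussian of variance $1-\eta+v_{\mathrm{el}}$. Then $\chi_{BE}=S(\rho_E)-\int p(y)S(\rho_{E|y})\,dy$, with $S$ the von Neumann entropy (natural logarithm); this does not depend on the purification. Write $\chi_{\mathrm{ben}}=\chi_{BE}(p_0)$. For a set $\mathcal{M}$ of monitored entries of $\Sigma$, with $\Pi_{\mathcal M}$ the projection onto those entries: - matching set $\mathcal{F}_{\mathcal M}=\{p\in\mathcal{D}:\Pi_{\mathcal M}\Sigma(p)=\Pi_{\mathcal M}\Sigma_0\}$; - $\mathcal{A}_{\mathcal M}(\chi_0)=\{p\in\mathcal{F}_{\mathcal M}:\chi_{BE}(p)\ge\chi_0\}$; - $\chi_{\max}^{\mathcal M}=\max_{p\in\mathcal{F}_{\mathcal M}}\chi_{BE}(p)$; - $g_{\mathcal M}(\chi_0)=\inf_{p\in\mathcal{A}_{\mathcal M}(\chi_0)}D(\Sigma_0\Vert\Sigma(p))$. The trusted-correlation model is the case where $\mathcal{M}$ consists of the entries $V_A$ and $\sqrt{\eta T}\,V_A$, so that $\mathcal{F}_{\mathcal M}=\{T_0\}\times[0,\xi_{\max}]$. A point $p^\star\in\mathcal{F}_{\mathcal M}$ is a local minimizer of $D$ on $\mathcal{F}_{\mathcal M}$ if there is a relatively open $U\subseteq\mathcal{F}_{\mathcal M}$ containing $p^\star$ with $D(p^\star)\le D(p)$ for all $p\in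 U$. Untrusted shot-noise unit: the eavesdropper can rescale the inferred shot-noise unit so that the observed covariance matrix equals $\Sigma_0$ whatever the underlying physical channel (whose Holevo leakage may be arbitrarily large); in this case $g_{\mathcal M}(\chi_0)$ is the infimum of $D(\Sigma_0\Vert\Sigma_{\mathrm{obs}})$ over attacks with leakage at least $\chi_0$, where $\Sigma_{\mathrm{obs}}$ is the observed covariance. *)

(* Defs.v *)
From HB Require Import structures.
From mathcomp Require Import all_boot all_order all_algebra.
From mathcomp Require Import all_classical all_reals all_analysis.
From mathcomp.real_closed Require Import complex.

Set Implicit Arguments.
Unset Strict Implicit.
Unset Printing Implicit Defensive.

Import Order.TTheory GRing.Theory Num.Theory.
Import numFieldNormedType.Exports.

Local Open Scope classical_set_scope.
Local Open Scope ring_scope.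
Local Open Scope complex_scope.

Record setup (R : realType) := Setup {
  VA : R; eta : R; vel : R;
  Tmin : R; ximax : R;
  T0 : R; xi0 : R }.

Definition setup_ok (R : realType) (s : setup R) : Prop :=
  [/\ 0 < VA s, 0 < eta s <= 1, 0 <= vel s,
      0 < Tmin s <= T0 s /\ T0 s <= 1 & 0 <= xi0 s <= ximax s].

(* Parameter points are pairs p = (T, xi). *)
Definition p0 (R : realType) (s : setup R) : R * R := (T0 s, xi0 s).

Definition domain (R : realType) (s : setup R) : set (R * R) :=
  [set p | Tmin s <= p.1 <= 1 /\ 0 <= p.2 <= ximax s].

Section ComplexIntegration.
Variable R : realType.

Definition cintegral (d : measure_display) (T : measurableType d)
    (mu : {measure set T -> \bar R}) (D : set T) (f : T -> R[i]) : R[i] :=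
  (\int[mu]_(x in D) complex.Re (f x)) +i* (\int[mu]_(x in D) complex.Im (f x)).

Definition cmeasurable (d : measure_display) (T : measurableType d)
    (f : T -> R[i]) : Prop :=
  measurable_fun [set: T] (fun x => complex.Re (f x)) /\
  measurable_fun [set: T] (fun x => complex.Im (f x)).

Definition cintegrable (d : measure_display) (T : measurableType d)
    (mu : {measure set T -> \bar R}) (f : T -> R[i]) : Prop :=
  mu.-integrable [set: T] (fun x => (complex.Re (f x))%:E) /\
  mu.-integrable [set: T] (fun x => (complex.Im (f x))%:E).

Definition csq (z : R[i]) : R := complex.Re z ^+ 2 + complex.Im z ^+ 2.

Definition expi (t : R) : R[i] := cos t +i* sin t.

Definition csums_to (a : nat -> R[i]) (l : R[i]) : Prop :=
  (fun n => \sum_(k < n) complex.Re (a k)) @ \oo --> complex.Re l /\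
  (fun n => \sum_(k < n) complex.Im (a k)) @ \oo --> complex.Im l.

End ComplexIntegration.

Section VonNeumann.
Variable R : realType.

(* Operators on l^2(nat) are given by their matrix in the canonical basis.
   rho = sum_n mu_n |phi_n><phi_n| with (phi_n) orthonormal and mu_n >= 0;
   finite-rank operators are covered by padding with mu_n = 0. *)
Definition spectral_decomposition (rho : nat -> nat -> R[i])
    (mu : nat -> R) (phi : nat -> nat -> R[i]) : Prop :=
  [/\ forall n, 0 <= mu n,
      forall m n, csums_to (fun k => (phi m k)^* * phi n k) ((m == n)%:R)
    & forall i j,
        csums_to (fun n => (mu n)%:C * phi n i * (phi n j)^*) (rho i j)].

(* - tr (rho ln rho); the value does not depend on the decomposition, and
   0 ln 0 = 0 since ln 0 = 0 here. *)
Definition vN_entropy (rho : nat -> nat -> R[i]) : \bar R :=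
  xget 0%E [set S : \bar R | exists mu phi, spectral_decomposition rho mu phi /\
    S = (\sum_(0 <= n <oo) (- (mu n * ln (mu n)))%:E)%E].

End VonNeumann.

Section Holevo.
Variable R : realType.
Implicit Types (s : setup R) (T xi : R).

Local Notation leb := (@lebesgue_measure R).
Local Notation leb2 := ((@lebesgue_measure R) \x (@lebesgue_measure R))%E.
Local Notation plane := (measurableTypeR R * measurableTypeR R)%type.

(* Modes A and B live on L^2(R^2), q_A and q_B being multiplication by the
   coordinates.  Unit vacuum variance means [q, p] = 2i, that is p = -2i d/dq,
   so that
     exp(i(u q + v p)) psi (x) = exp(i u (x + v)) psi (x + 2 v).
   zA = (uA, vA) and zB = (uB, vB). *)
Definition weyl (zA zB : 'rV[R]_2) (psi : plane -> R[i]) : plane -> R[i] :=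
  fun x => expi (zA 0 0 * (x.1 + zA 0 1) + zB 0 0 * (x.2 + zB 0 1))
           * psi (x.1 + 2 * zA 0 1, x.2 + 2 * zB 0 1).

(* A unit vector of L^2(R^2) (x) l^2(nat), i.e. sum_n Psi_n (x) e_n: a pure
   state of A, B and E, the system E being l^2(nat). *)
Definition pure_state (Psi : nat -> plane -> R[i]) : Prop :=
  (forall n, cmeasurable (Psi n)) /\
  (\sum_(0 <= n <oo) \int[leb2]_x (csq (Psi n x))%:E = 1)%E.

Definition sigma_z : 'M[R]_2 :=
  \matrix_(i, j) (if i != j then 0 else if i == 0 then 1 else -1).

(* Quadratures are ordered q_A, p_A, q_B, p_B. *)
Definition gamma_AB s T xi : 'M[R]_(2 + 2) :=
  let V := VA s + 1 in
  let c := Num.sqrt (T * (V ^+ 2 - 1)) in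
  let b := T * (VA s + xi) + 1 in
  block_mx V%:M (c *: sigma_z) (c *: sigma_z) b%:M.

(* The reduced state on AB is the zero-mean Gaussian state with covariance
   gamma: its characteristic function tr (rho_AB W(z)) is
   exp(- z gamma z^T / 2). *)
Definition purifies (gamma : 'M[R]_(2 + 2)) (Psi : nat -> plane -> R[i]) : Prop :=
  pure_state Psi /\
  forall zA zB : 'rV[R]_2, let z := row_mx zA zB in
    csums_to
      (fun n => cintegral leb2 setT
                  (fun x : plane => (Psi n x)^* * weyl zA zB (Psi n) x))
      (expR (- (2^-1 * (z *m gamma *m z^T) 0 0)))%:C.

(* Matrix of rho_E = tr_AB |Psi><Psi|. *)
Definition rho_E (Psi : nat -> plane -> R[i]) (i j : nat) : R[i] :=
  cintegral leb2 setT (fun x : plane => Psi i x * (Psi j x)^*).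

(* Law of w; normal_prob is not a Dirac mass when the standard deviation is
   0, which happens for eta = 1 and v_el = 0. *)
Definition noise_law s (B : set R) : \bar R :=
  let v := 1 - eta s + vel s in
  if v == 0 then \d_(0 : R) B else normal_prob 0 (Num.sqrt v) B.

(* The effect of the event y \in B is multiplication by
   P(sqrt(eta) q_B + w \in B). *)
Definition detection s (B : set R) (qB : R) : R :=
  fine (noise_law s [set w | B (Num.sqrt (eta s) * qB + w)]).

(* p is the density of y, and (rhoy y) the state of E given y: for every Borel
   set B, int_B p(y) rhoy(y) dy is the unnormalized state of E after the event
   y \in B. *)
Definition conditional_states s (Psi : nat -> plane -> R[i])
    (p : R -> R) (rhoy : R -> nat -> nat -> R[i]) : Prop :=
  [/\ measurable_fun [set: measurableTypeR R] p /\ (forall y, 0 <= p y),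
      forall B : set (measurableTypeR R), measurable B ->
        (\int[leb]_(y in B) (p y)%:E =
         \sum_(0 <= n <oo)
            \int[leb2]_x (csq (Psi n x) * detection s B x.2)%:E)%E,
      forall i j, cintegrable leb
        (fun y : measurableTypeR R => (p y)%:C * rhoy y i j)
    & forall i j (B : set (measurableTypeR R)), measurable B ->
        cintegral leb B (fun y => (p y)%:C * rhoy y i j) =
        cintegral leb2 setT
          (fun x : plane => Psi i x * (Psi j x)^* * (detection s B x.2)%:C)].

Definition is_holevo s T xi (c : R) : Prop :=
  exists Psi p rhoy,
    [/\ purifies (gamma_AB s T xi) Psi,
        conditional_states s Psi p rhoy
      & (c%:E = vN_entropy (rho_E Psi)
                - \int[leb]_y ((p y)%:E * vN_entropy (rhoy y)))%E].

(* chi_BE: the value is the same for all purifications. *)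
Definition holevo s (q : R * R) : R := xget 0 [set c | is_holevo s q.1 q.2 c].

End Holevo.

Section Detection.
Variable R : realType.
Implicit Types (s : setup R) (M : {set 'I_2 * 'I_2}).

Definition Sigma s (p : R * R) : 'M[R]_2 :=
  let T := p.1 in
  let N := 1 + vel s + eta s * T * p.2 in
  \matrix_(i, j) (if i != j then Num.sqrt (eta s * T) * VA s
                  else if i == 0 then VA s
                  else eta s * T * VA s + N).

Definition Sigma0 s : 'M[R]_2 := Sigma s (p0 s).

Definition posdef (A : 'M[R]_2) : Prop :=
  A^T = A /\ forall v : 'rV[R]_2, v != 0 -> 0 < (v *m A *m v^T) 0 0.

(* D(A || B) for positive definite A and B. *)
Definition rel_entropy (A B : 'M[R]_2) : R :=
  2^-1 * (\tr (invmx B *m A) - 2 + ln (\det B / \det A)).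

(* M is a set of positions; index 0 is Alice, 1 is Bob. *)
Definition matching s M : set (R * R) :=
  [set p | domain s p /\
     forall i j, (i, j) \in M -> Sigma s p i j = Sigma0 s i j].

(* The two off-diagonal positions carry the same entry sqrt(eta T) V_A. *)
Definition trusted_correlation M : bool :=
  [&& (0, 0) \in M, ((0, 1) \in M) || ((1, 0) \in M) & (1, 1) \notin M].

(* Infimum of D(Sigma0 || obs a) over the a in F with leakage at least chi0;
   it is +oo when there is no such a. *)
Definition inf_detection s (X : Type) (F : set X) (leak : X -> R)
    (obs : X -> 'M[R]_2) (chi0 : R) : \bar R :=
  ereal_inf [set (rel_entropy (Sigma0 s) (obs a))%:E
            | a in F `&` [set a | chi0 <= leak a]].

(* Trusted shot-noise unit: the observed covariance is Sigma p itself. *)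
Definition g s M : R -> \bar R :=
  inf_detection s (matching s M) (holevo s) (Sigma s).

Definition chi_ben s : R := holevo s (p0 s).

(* A maximum, by compactness, when holevo is continuous on the domain. *)
Definition chi_max s M : R := sup [set holevo s p | p in matching s M].

Definition chi_range s M : set R := [set x | chi_ben s < x < chi_max s M].

Definition local_minimizer (F : set (R * R)) (D : R * R -> R) (p : R * R) : Prop :=
  F p /\ exists U : set (R * R),
    [/\ exists2 V : set (R * R), open V & U = F `&` V,
        U p & forall q, U q -> D p <= D q].

Definition homeomorphism_onto_image (D : set (R * R))
    (f : R * R -> 'M[R]_2) : Prop :=
  {within D, continuous f} /\
  exists2 h : 'M[R]_2 -> R * R,
    (forall p, D p -> h (f p) = p) & {within [set f p | p in D], continuous h}.

Definition strictly_increasing_on (I : set R) (f : R -> \bar R) : Prop :=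
  forall x y, I x -> I y -> x < y -> (f x < f y)%E.

Definition single_valued_inverse_on (I : set R) (f : R -> \bar R) : Prop :=
  forall d, [set f x | x in I] d -> exists! x, I x /\ f x = d.

Definition physical_channel : set (R * R) := [set q | 0 < q.1 <= 1 /\ 0 <= q.2].

(* An attack is an underlying channel together with a manipulation (in Cal) of
   the inferred shot-noise unit; obs gives the resulting observed covariance.
   Whatever the channel, some manipulation makes it equal to Sigma0. *)
Definition untrusted_snu s (Cal : Type) (obs : (R * R) * Cal -> 'M[R]_2) : Prop :=
  (forall a, physical_channel a.1 -> posdef (obs a)) /\
  (forall q, physical_channel q -> exists r, obs (q, r) = Sigma0 s).

Definition g_untrusted s (Cal : Type) (obs : (R * R) * Cal -> 'M[R]_2) :
    R -> \bar R :=
  inf_detection s [set a | physical_channel a.1] (fun a => holevo s a.1) obs.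

Definition arbitrarily_large_leakage s : Prop :=
  forall L, exists2 q, physical_channel q & L <= holevo s q.

End Detection.

(* Main.v *)
(* The leakage enters only through its continuity.  Regressing Bob on Alice
   (quadratures with slope k, input variance v, residual variance n) splits the
   Gaussian divergence as
     2 D = h(v0/v) + h(n0/n) + v0 (k - k0)^2 / n,   h(r) = r - 1 - ln r >= 0,
   so D >= 0 and D vanishes on the domain only at p0.  By compactness the infimum
   g(x) is attained at some q; D(q) = 0 would force q = p0, whose leakage is
   below x.  If g(x) = g(y) with x < y, a minimizer q for y also minimizes D on
   the superlevel set of x and has leakage > x, so by continuity it is a local
   minimizer of D on the matching set, i.e. q = p0, a contradiction.  In the
   trusted-correlation model T = T0, and h decreases on ]0, 1] and increases on
   [1, +oo[, so p0 is indeed the only local minimizer. *)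
Require Import Defs.
From mathcomp Require Import all_boot all_order all_algebra.
From mathcomp Require Import all_classical all_reals all_analysis.
From mathcomp.real_closed Require Import complex.
From mathcomp Require Import ring lra.
Set Implicit Arguments.
Unset Strict Implicit.
Unset Printing Implicit Defensive.
Import Order.TTheory GRing.Theory Num.Theory.
Import numFieldNormedType.Exports.
Local Open Scope classical_set_scope.
Local Open Scope ring_scope.

(** * The function r - 1 - ln r and its monotonicity on either side of 1 *)

Section LogarithmicGap.
Variable R : realType.
Implicit Types x y r k v n : R.

Definition log_gap r : R := r - 1 - ln r.

Lemma log_gap1 : log_gap 1 = 0.
Proof. by rewrite /log_gap subrr ln1 subr0. Qed.

(** Strict convexity of the exponential: 1 + u < exp u for nonzero u, taken at u = r - 1. *)
Lemma ln_lt_sub1 r : 0 < r -> r != 1 -> ln r < r - 1.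
Proof.
move=> r0 r1; rewrite -ltr_expR lnK ?posrE//.
have /expR_gt1Dx : r - 1 != 0 by rewrite subr_eq0.
by rewrite addrC subrK.
Qed.

Lemma log_gap_gt0 r : 0 < r -> r != 1 -> 0 < log_gap r.
Proof. by move=> r0 r1; rewrite subr_gt0 ln_lt_sub1. Qed.

Lemma log_gap_ge0 r : 0 < r -> 0 <= log_gap r.
Proof.
move=> r0; have [->|r1] := eqVneq r 1; first by rewrite log_gap1.
exact: ltW (log_gap_gt0 r0 r1).
Qed.

Lemma log_gap_eq0 r : 0 < r -> log_gap r = 0 -> r = 1.
Proof.
move=> r0 h; apply/eqP; apply: contraT => /(log_gap_gt0 r0).
by rewrite h ltxx.
Qed.

Lemma log_gap_sub x y : 0 < x -> 0 < y ->
  log_gap y - log_gap x = (y - x) - ln (y / x).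
Proof.
by move=> x0 y0; rewrite /log_gap ln_div ?posrE//; ring.
Qed.

Lemma ln_div_lt x y : 0 < x -> 0 < y -> x != y -> ln (y / x) < (y - x) / x.
Proof.
move=> x0 y0 xy; rewrite mulrBl divff ?gt_eqF// ln_lt_sub1 ?divr_gt0//.
apply: contraNN xy => /eqP yx1.
by rewrite -[y](divfK (lt0r_neq0 x0)) yx1 mul1r.
Qed.

(** The tangent bound at y / x gives ln (y / x) < (y - x) / x, which is at most y - x because 1 <=
    x. *)
Lemma log_gap_increasing x y : 1 <= x -> x < y -> log_gap x < log_gap y.
Proof.
move=> x1 xy; have x0 : 0 < x by lra.
have y0 : 0 < y by lra.
rewrite -subr_gt0 log_gap_sub// subr_gt0.
apply: lt_le_trans (ln_div_lt x0 y0 _) _; first by rewrite lt_eqF.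
rewrite ler_pdivrMr//; nra.
Qed.

(** The same bound with x and y exchanged: (x - y) / y <= x - y, since x - y is negative and y <=
    1. *)
Lemma log_gap_decreasing x y : 0 < x -> x < y -> y <= 1 ->
  log_gap y < log_gap x.
Proof.
move=> x0 xy y1; have y0 : 0 < y by lra.
rewrite -subr_gt0 log_gap_sub// subr_gt0.
apply: lt_le_trans (ln_div_lt y0 x0 _) _; first by rewrite gt_eqF.
rewrite ler_pdivrMr//; nra.
Qed.

End LogarithmicGap.

(** * Gaussian divergence in regression coordinates *)

Section RelativeEntropy.
Variable R : realType.
Implicit Types k v n : R.

(* The covariance of (x, k x + z) for independent x and z of variances v, n. *)
Definition regression_mx k v n : 'M[R]_2 :=
  \matrix_(i, j) (if i != j then k * v
                  else if i == 0 then v else k ^+ 2 * v + n).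

(** Matrix of the quadratic form a^2 / v + (b - k a)^2 / n, read off from the joint density of [x]
    and the residual. *)
Definition regression_invmx k v n : 'M[R]_2 :=
  \matrix_(i, j) (if i != j then - k / n
                  else if i == 0 then v^-1 + k ^+ 2 / n else n^-1).

Lemma regression_mxK k v n : v != 0 -> n != 0 ->
  invmx (regression_mx k v n) = regression_invmx k v n.
Proof.
move=> v0 n0.
have JL : regression_invmx k v n *m regression_mx k v n = 1%:M.
  apply/matrixP => i j; rewrite !mxE !big_ord_recl big_ord0 !mxE /=.
  case: i => -[|[|//]] hi; case: j => -[|[|//]] hj //=; rewrite -?val_eqE/=;
    field; rewrite ?v0 ?n0 //.
have [_ Lu] := mulmx1_unit JL.
by rewrite -[LHS]mul1mx -JL -mulmxA mulmxV// mulmx1.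
Qed.

Lemma det_regression_mx k v n : \det (regression_mx k v n) = v * n.
Proof.
rewrite (expand_det_row _ ord0) !big_ord_recl big_ord0 /cofactor !det_mx11.
rewrite !mxE /= /bump /=. ring.
Qed.

(** Chain rule for relative entropy: one term for the input marginals, one for the residuals, and
    the slope mismatch averaged over an input of variance [v0]. *)
Lemma rel_entropy_regression k0 v0 n0 k v n :
  0 < v0 -> 0 < n0 -> 0 < v -> 0 < n ->
  rel_entropy (regression_mx k0 v0 n0) (regression_mx k v n) =
  2^-1 * (log_gap (v0 / v) + log_gap (n0 / n) + v0 * (k - k0) ^+ 2 / n).
Proof.
move=> v00 n00 vp np; rewrite /rel_entropy /log_gap.
rewrite regression_mxK ?gt_eqF// !det_regression_mx.
(* In this form the logarithm of the determinant ratio splits into the two logarithms of the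
   [log_gap] terms. *)
have -> : v * n / (v0 * n0) = ((v0 / v) * (n0 / n))^-1.
  by field; rewrite !gt_eqF.
rewrite lnV ?posrE ?mulr_gt0 ?invr_gt0// lnM ?posrE ?mulr_gt0 ?invr_gt0//.
rewrite /mxtrace !big_ord_recl big_ord0 !mxE !big_ord_recl !big_ord0 !mxE /=.
by field; rewrite !gt_eqF.
Qed.

Lemma rel_entropy_regression_ge0 k0 v0 n0 k v n :
  0 < v0 -> 0 < n0 -> 0 < v -> 0 < n ->
  0 <= rel_entropy (regression_mx k0 v0 n0) (regression_mx k v n).
Proof.
move=> v00 n00 vp np; rewrite rel_entropy_regression// mulr_ge0//.
apply: addr_ge0; first by rewrite addr_ge0 ?log_gap_ge0 ?divr_gt0.
by apply: divr_ge0; [apply: mulr_ge0; [exact: ltW|exact: sqr_ge0]|exact: ltW].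
Qed.

(** Regression of the second coordinate on the first: the slope is A01 / A00 and the residual
    variance is the Schur complement. This brings arbitrary observed covariances within reach of the
    chain rule. *)
Lemma posdef_regression (A : 'M[R]_2) : posdef A ->
  exists k v n, [/\ 0 < v, 0 < n & A = regression_mx k v n].
Proof.
move=> [symA posA].
have A10 : A 1 0 = A 0 1 by rewrite -[in LHS]symA mxE.
have quad a b : ((\row_(i < 2) (if i == 0 then a else b)) *m A *m
    (\row_(i < 2) (if i == 0 then a else b))^T) 0 0
    = a ^+ 2 * A 0 0 + 2 * a * b * A 0 1 + b ^+ 2 * A 1 1.
  rewrite !mxE !big_ord_recl big_ord0 !mxE !big_ord_recl !big_ord0 !mxE /=.
  have -> : lift ord0 ord0 = 1 :> 'I_2 by apply/val_inj.
  by rewrite A10; ring.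
have v0 : 0 < A 0 0.
  have := posA (\row_(i < 2) (if i == 0 then 1 else 0)).
  rewrite quad expr1n mul1r mulr0 mul0r expr0n /= mul0r !addr0; apply.
  apply/eqP => /rowP /(_ 0); rewrite !mxE /= => /eqP.
  by rewrite oner_eq0.
have n0 : 0 < A 1 1 - (A 0 1 / A 0 0) ^+ 2 * A 0 0.
  (* The test vector (-k, 1) represents the residual, so the form takes the Schur complement as its
     value there. *)
  have := posA (\row_(i < 2) (if i == 0 then - (A 0 1 / A 0 0) else 1)).
  rewrite quad => H.
  suff -> : A 1 1 - (A 0 1 / A 0 0) ^+ 2 * A 0 0 =
    (- (A 0 1 / A 0 0)) ^+ 2 * A 0 0 + 2 * - (A 0 1 / A 0 0) * 1 * A 0 1
      + 1 ^+ 2 * A 1 1.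
    apply: H; apply/eqP => /rowP /(_ 1); rewrite !mxE /= => /eqP.
    by rewrite oner_eq0.
  by field; rewrite gt_eqF.
exists (A 0 1 / A 0 0), (A 0 0), (A 1 1 - (A 0 1 / A 0 0) ^+ 2 * A 0 0).
split=> //; apply/matrixP => i j; rewrite !mxE.
have ordE (l : 'I_2) : l = 0 \/ l = 1.
  by case: l => -[|[|//]] ?; [left|right]; apply/val_inj.
case: (ordE i) => ->; case: (ordE j) => -> //=.
- by rewrite divfK// gt_eqF.
- by rewrite A10 divfK// gt_eqF.
- by rewrite addrC subrK.
Qed.

End RelativeEntropy.

(** * Minimization over superlevel sets in a compact set *)

Section Superlevel.
Variables (R : realType) (T : topologicalType) (F : set T) (c D : T -> R).
Hypotheses (cptF : compact F) (cc : {within F, continuous c})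
  (cD : {within F, continuous D}).

(** Continuity holds only within [F], so the superlevel set is closed in the subspace topology; it
    is the trace on [F] of an ambient closed set [V]. *)
Lemma superlevel_compact x : compact (F `&` [set p | x <= c p]).
Proof.
have : closed ((c : subspace F -> R) @^-1` [set y | x <= y]).
  by move/continuous_closedP : cc => /(_ _ (@closed_ge _ x)).
move=> /closed_subspaceP[V cV VF].
rewrite (_ : F `&` _ = F `&` V); first exact: compact_closedI.
by rewrite ![F `&` _]setIC VF.
Qed.

Lemma superlevel_argmin x : (F `&` [set p | x <= c p]) !=set0 ->
  exists q, [/\ F q, x <= c q & forall p, F p -> x <= c p -> D q <= D p].
Proof.
move=> A0.
have cDA : {within F `&` [set p | x <= c p], continuous D}.
  exact: continuous_subspaceW (@subIsetl _ _ _) cD.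
have [q] := compact_EVT_min A0 (superlevel_compact (x := x)) cDA.
rewrite inE => -[Fq xq] qmin; exists q; split=> // p Fp xp.
by apply: qmin; rewrite inE.
Qed.

End Superlevel.

(** The strict inequality x < c q makes the set where [c] exceeds [x] a relative neighborhood of
    [q], and [q] is minimal on it. *)
Lemma superlevel_minimizer_local (R : realType) (F : set (R * R))
    (c D : R * R -> R) (x : R) (q : R * R) :
  {within F, continuous c} -> F q -> x < c q ->
  (forall p, F p -> x <= c p -> D q <= D p) -> local_minimizer F D q.
Proof.
move=> cc Fq xq qmin.
have : open ((c : subspace F -> R) @^-1` [set y | x < y]).
  by move/continuousP : cc => /(_ _ (@open_gt _ x)).
move=> /open_subspaceP[V oV VF]; split=> //.
exists (F `&` V); split; first by exists V.
  by rewrite setIC VF.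
by rewrite setIC VF => p [/= xp Fp]; exact: qmin (ltW xp).
Qed.

(** * The covariance family, its divergence from the benign point, and the matching sets *)

Section SigmaFamily.
Context (R : realType) (s : setup R).
Hypothesis hs : setup_ok s.
Implicit Types (p q : R * R) (M : {set 'I_2 * 'I_2}).

Let VA0 : 0 < VA s. Proof. by case: hs. Qed.
Let eta0 : 0 < eta s. Proof. by case: hs => _ /andP[]. Qed.

Definition noise p : R := 1 + vel s + eta s * p.1 * p.2.

Lemma physical_domain p : domain s p -> physical_channel p.
Proof.
case: hs => _ _ _ [/andP[Tmin0 _] _] _ [/andP[Tp Tp1] /andP[xi_ge0 _]].
by split=> //; rewrite Tp1 (lt_le_trans Tmin0).
Qed.

Lemma domain_p0 : domain s (p0 s).
Proof. by case: hs => _ _ _ [/andP[_ TT0] T01] xi0b; rewrite /domain /= TT0 T01. Qed.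

Lemma physical_p0 : physical_channel (p0 s).
Proof. exact: physical_domain domain_p0. Qed.

Lemma noise_gt0 p : physical_channel p -> 0 < noise p.
Proof.
case: hs => _ _ v0 _ _ [/andP[T0 _] xi0].
by rewrite ltr_wpDr ?mulr_ge0 ?(ltW eta0) ?(ltW T0) ?ltr_wpDr.
Qed.

(** Bob's quadrature is sqrt(eta T) times Alice's plus independent noise; the squared slope is eta T
    because eta T >= 0. *)
Lemma SigmaE p : physical_channel p ->
  Sigma s p = regression_mx (Num.sqrt (eta s * p.1)) (VA s) (noise p).
Proof.
move=> [/andP[T0 _] _]; apply/matrixP => i j.
by rewrite !mxE sqr_sqrtr// mulr_ge0// ltW.
Qed.

Lemma rel_entropy_SigmaE p : physical_channel p ->
  rel_entropy (Sigma0 s) (Sigma s p) =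
  2^-1 * (log_gap (noise (p0 s) / noise p) +
    VA s * (Num.sqrt (eta s * p.1) - Num.sqrt (eta s * T0 s)) ^+ 2 / noise p).
Proof.
move=> pp; rewrite /Sigma0 !SigmaE//; last exact: physical_p0.
rewrite rel_entropy_regression ?noise_gt0//; last exact: physical_p0.
by rewrite divff ?gt_eqF// log_gap1 add0r.
Qed.

Lemma rel_entropy_Sigma0_ge0 (B : 'M[R]_2) : posdef B ->
  0 <= rel_entropy (Sigma0 s) B.
Proof.
move=> /posdef_regression[k [v [n [v0 n0 ->]]]].
rewrite /Sigma0 SigmaE; last exact: physical_p0.
by apply: rel_entropy_regression_ge0; rewrite ?noise_gt0//; exact: physical_p0.
Qed.

Lemma rel_entropy_Sigma_ge0 p : physical_channel p ->
  0 <= rel_entropy (Sigma0 s) (Sigma s p).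
Proof.
move=> pp; rewrite /Sigma0 !SigmaE//; last exact: physical_p0.
by apply: rel_entropy_regression_ge0; rewrite ?noise_gt0//; exact: physical_p0.
Qed.

Lemma rel_entropy_Sigma00 : rel_entropy (Sigma0 s) (Sigma0 s) = 0.
Proof.
rewrite rel_entropy_SigmaE; last exact: physical_p0.
by rewrite subrr expr0n /= mulr0 mul0r addr0 divff ?log_gap1 ?mulr0// gt_eqF//
  noise_gt0//; exact: physical_p0.
Qed.

(** Both nonnegative terms vanish. The slope term identifies T; the noise term then identifies xi,
    whose coefficient eta T is nonzero. *)
Lemma rel_entropy_Sigma_eq0 p : physical_channel p ->
  rel_entropy (Sigma0 s) (Sigma s p) = 0 -> p = p0 s.
Proof.
move=> pp; rewrite rel_entropy_SigmaE//.
have Np := noise_gt0 pp; have N0 := noise_gt0 physical_p0.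
have [/andP[Tp _] _] := pp; have [/andP[T0p _] _] := physical_p0.
have Nr : 0 < noise (p0 s) / noise p by rewrite divr_gt0.
move=> /eqP; rewrite mulf_eq0 invr_eq0 pnatr_eq0 /= paddr_eq0; last 2 first.
- exact: log_gap_ge0.
- by apply: divr_ge0; [apply: mulr_ge0; [exact: ltW|exact: sqr_ge0]|exact: ltW].
move=> /andP[/eqP/(log_gap_eq0 Nr) NE].
rewrite mulf_eq0 invr_eq0 (gt_eqF Np) orbF mulf_eq0 (gt_eqF VA0) sqrf_eq0 subr_eq0.
rewrite eqr_sqrt ?mulr_ge0 ?(ltW eta0) ?(ltW Tp) ?(ltW T0p)//.
move=> /eqP/(mulfI (lt0r_neq0 eta0)) TE.
have /eqP : noise p = noise (p0 s).
  by rewrite -[RHS](divfK (lt0r_neq0 Np)) NE mul1r.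
rewrite /noise TE /= (inj_eq (addrI _)) => /eqP /mulfI xiE.
rewrite [p]surjective_pairing TE xiE//.
by rewrite mulf_neq0 ?gt_eqF.
Qed.

Lemma noise_continuous : continuous noise.
Proof.
move=> p; apply: cvgD; first exact: cvg_cst.
apply: cvgM; last exact: cvg_snd.
by apply: cvgM; [exact: cvg_cst|exact: cvg_fst].
Qed.

Lemma sqrt_eta_continuous :
  continuous (fun p : R * R => Num.sqrt (eta s * p.1)).
Proof.
move=> p; apply: (@cvg_comp _ _ _ (fun p : R * R => eta s * p.1)); last first.
  exact: sqrt_continuous.
by apply: cvgM; [exact: cvg_cst|exact: cvg_fst].
Qed.

Lemma Sigma_entry_continuous i j : continuous (fun p => Sigma s p i j).
Proof.
rewrite (_ : (fun p => _) = fun p => if i != j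
    then Num.sqrt (eta s * p.1) * VA s
    else if i == 0 then VA s
    else eta s * p.1 * VA s + noise p); last first.
  by apply/funext => p; rewrite mxE.
move=> p; case: (i != j); last case: (i == 0).
- by apply: cvgM; [exact: sqrt_eta_continuous|exact: cvg_cst].
- exact: cvg_cst.
- apply: cvgD; last exact: noise_continuous.
  apply: cvgM; last exact: cvg_cst.
  by apply: cvgM; [exact: cvg_cst|exact: cvg_fst].
Qed.

Lemma rel_entropy_Sigma_continuous :
  {within domain s, continuous (fun p => rel_entropy (Sigma0 s) (Sigma s p))}.
Proof.
pose f p := 2^-1 * (log_gap (noise (p0 s) / noise p) +
  VA s * (Num.sqrt (eta s * p.1) - Num.sqrt (eta s * T0 s)) ^+ 2 / noise p).
(* On the domain the divergence is replaced by its closed form, free of matrix inverses and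
   determinants. *)
apply: (@subspace_eq_continuous _ _ _ (f : subspace (domain s) -> R)).
  by move=> p; rewrite inE => /physical_domain pp; rewrite /from_subspace /= rel_entropy_SigmaE.
apply: continuous_in_subspaceT => p; rewrite inE => /physical_domain pp.
have Np := noise_gt0 pp; have N0 := noise_gt0 physical_p0.
have cinv : (noise q)^-1 @[q --> p] --> (noise p)^-1.
  by apply: cvgV; [rewrite gt_eqF|exact: noise_continuous].
have cr : noise (p0 s) / noise q @[q --> p] --> noise (p0 s) / noise p.
  by apply: cvgM => //; exact: cvg_cst.
apply: cvgM; first exact: cvg_cst.
apply: cvgD; last first.
  apply: cvgM => //; apply: cvgM; first exact: cvg_cst.
  have cd : Num.sqrt (eta s * q.1) - Num.sqrt (eta s * T0 s) @[q --> p] -->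
            Num.sqrt (eta s * p.1) - Num.sqrt (eta s * T0 s).
    by apply: cvgB; [exact: sqrt_eta_continuous|exact: cvg_cst].
  exact: (cvgM cd cd).
apply: cvgB; first by apply: cvgB => //; exact: cvg_cst.
apply: (@cvg_comp _ _ _ (fun q => noise (p0 s) / noise q) (@ln R) _ _ _ cr).
by apply: continuous_ln; rewrite divr_gt0.
Qed.

Lemma matching_sub_domain M : matching s M `<=` domain s.
Proof. by move=> p []. Qed.

Lemma matching_p0 M : matching s M (p0 s).
Proof. by split=> //; exact: domain_p0. Qed.

Lemma domain_compact : compact (domain s).
Proof.
rewrite (_ : domain s = `[Tmin s, 1]%classic `*` `[0, ximax s]%classic).
  by apply: compact_setX; exact: segment_compact.
by apply/seteqP; split=> p; rewrite /domain /= !in_itv.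
Qed.

Lemma matching_compact M : compact (matching s M).
Proof.
rewrite (_ : matching s M = domain s `&`
    \bigcap_(ij in [set ij | ij \in M])
      (fun p => Sigma s p ij.1 ij.2) @^-1` [set Sigma0 s ij.1 ij.2]).
  apply: compact_closedI; first exact: domain_compact.
  apply: closed_bigI => ij _; apply: preimage_closed; last exact: closed_eq.
  by move=> p _; exact: Sigma_entry_continuous.
apply/seteqP; split=> p [dp pM]; split=> //.
  by move=> [i j] /= ijM; exact: pM.
by move=> i j ijM; exact: pM (i, j) ijM.
Qed.

(** The correlation sqrt(eta T) V_A pins T, while Bob's variance, the only entry depending on xi, is
    outside [M]. *)
Lemma trusted_matching M p : trusted_correlation M ->
  matching s M p <-> p.1 = T0 s /\ 0 <= p.2 <= ximax s.
Proof.
move=> /and3P[_ M01 M11]; have [T0dom _] := domain_p0.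
split=> [[[/andP[Tp _] xip] pM]|[TE xip]]; last first.
  split; first by rewrite /domain /= TE.
  move=> i j ijM; rewrite !mxE /= TE; case: ifP => // /negbFE/eqP ij.
  (* The remaining position is (1, 1), which [M] excludes. *)
  case: ifP => // i0; case/negP: M11.
  suff i1 : i = 1 by rewrite -i1 [X in (_, X)]ij.
  by case: i i0 {ijM ij} => -[|[|//]] ilt // _; apply/val_inj.
split=> //.
have /eqP : Num.sqrt (eta s * p.1) * VA s = Num.sqrt (eta s * T0 s) * VA s.
  by case/orP : M01 => /pM; rewrite !mxE.
rewrite (inj_eq (mulIf (lt0r_neq0 VA0))).
have [/andP[Tmin0 _] _] : 0 < Tmin s <= T0 s /\ T0 s <= 1 by case: hs.
have [/andP[T00 _] _] := physical_p0.
rewrite eqr_sqrt ?mulr_ge0 ?(ltW eta0) ?(ltW T00) ?(le_trans (ltW Tmin0))//.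
by move=> /eqP/(mulfI (lt0r_neq0 eta0)).
Qed.

(* On the slice T = T0 the divergence is log_gap of a monotone function of xi
   which equals 1 exactly at xi0. *)
Lemma rel_entropy_slice_lt x y : 0 <= x -> 0 <= y ->
  (x < y /\ y <= xi0 s) \/ (xi0 s <= y /\ y < x) ->
  rel_entropy (Sigma0 s) (Sigma s (T0 s, y)) <
  rel_entropy (Sigma0 s) (Sigma s (T0 s, x)).
Proof.
move=> x0 y0 xy; have [T0b _] := physical_p0.
have [T00 _] := andP T0b.
have ph z : 0 <= z -> physical_channel (T0 s, z) by [].
have slice z : 0 <= z -> rel_entropy (Sigma0 s) (Sigma s (T0 s, z)) =
    2^-1 * log_gap (noise (p0 s) / noise (T0 s, z)).
  move=> z0; rewrite rel_entropy_SigmaE; last exact: ph.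
  by rewrite subrr expr0n /= mulr0 mul0r addr0.
have Nlt z w : z < w -> noise (T0 s, z) < noise (T0 s, w).
  by move=> zw; rewrite ltrD2l ltr_pM2l// mulr_gt0.
have Nle z w : z <= w -> noise (T0 s, z) <= noise (T0 s, w).
  by move=> zw; rewrite lerD2l ler_pM2l// mulr_gt0.
have Nx := noise_gt0 (ph _ x0); have Ny := noise_gt0 (ph _ y0).
have N0 := noise_gt0 physical_p0.
rewrite !slice// ltr_pM2l ?invr_gt0//.
case: xy => -[h1 h2]; [apply: log_gap_increasing|apply: log_gap_decreasing].
- by rewrite ler_pdivlMr// mul1r Nle.
- by rewrite ltr_pM2l// ltf_pV2 ?posrE// Nlt.
- by rewrite divr_gt0.
- by rewrite ltr_pM2l// ltf_pV2 ?posrE// Nlt.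
- by rewrite ler_pdivrMr// mul1r Nle.
Qed.

(** At [p0] the divergence attains its global minimum 0. From any other point of the slice, a small
    move of xi towards [xi0] strictly lowers the divergence. *)
Lemma trusted_local_minimizer M p : trusted_correlation M ->
  local_minimizer (matching s M)
    (fun q => rel_entropy (Sigma0 s) (Sigma s q)) p <-> p = p0 s.
Proof.
move=> trM; split=> [[Fp [U [[V oV UE] Up pmin]]]|->]; last first.
  split; first exact: matching_p0.
  exists (matching s M); split; last 2 first.
  - exact: matching_p0.
  - move=> q /matching_sub_domain/physical_domain pq.
    by rewrite rel_entropy_Sigma00 rel_entropy_Sigma_ge0.
  by exists setT; [exact: openT|rewrite setIT].
have [TE /andP[xi_ge0 xi_le]] := (trusted_matching _ trM).1 Fp.
case: p => T xi /= in Fp Up pmin TE xi_ge0 xi_le *; subst T.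
apply: contrapT => pp0.
have xi_neq : xi != xi0 s by apply/eqP => xiE; apply: pp0; rewrite xiE.
have [_ /andP[xi00 xi0m]] := domain_p0; rewrite /= in xi00 xi0m.
(* Segment from (T0, xi) at t = 0 to [p0] at t = 1. *)
pose gam (t : R) := (T0 s, xi + t * (xi0 s - xi)).
have cxi : xi + t * (xi0 s - xi) @[t --> (0 : R)] --> xi + 0 * (xi0 s - xi).
  apply: cvgD; first exact: cvg_cst.
  by apply: cvgM; [exact: cvg_id|exact: cvg_cst].
have cgam : gam t @[t --> (0 : R)] --> gam 0.
  exact: (cvg_pair (cvg_cst (T0 s)) cxi).
have gam0 : gam 0 = (T0 s, xi) by rewrite /gam mul0r addr0.
have nV : \forall t \near (0 : R), V (gam t).
  apply: cgam; rewrite gam0; apply: open_nbhs_nbhs; split=> //.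
  by move: Up; rewrite UE => -[].
have [t [t0 t1 Vt]] : exists t : R, [/\ 0 < t, t < 1 & V (gam t)].
  (* The right-sided filter at 0 provides a positive t small enough for [gam t] to stay in [V]. *)
  have : \forall t \near (0 : R)^'+, [/\ 0 < t, t < 1 & V (gam t)].
    near=> t; split; first by near: t; exact: nbhs_right_gt.
      by near: t; exact: nbhs_right_lt.
    by near: t; exact: cvg_within nV.
  exact: filter_ex.
pose z := xi + t * (xi0 s - xi).
have zb : (xi < z /\ z <= xi0 s) \/ (xi0 s <= z /\ z < xi).
  rewrite /z; move: xi_neq; rewrite neq_lt => /orP[h|h]; [left|right]; split; nra.
have z0 : 0 <= z by case: zb => -[]; lra.
have Uz : U (T0 s, z).
  rewrite UE; split=> //; apply/(trusted_matching _ trM); split=> //=.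
  by rewrite z0 /=; case: zb => -[]; lra.
have := pmin _ Uz; rewrite leNgt.
by rewrite rel_entropy_slice_lt.
Unshelve. all: by end_near.
Qed.

End SigmaFamily.

Lemma strictly_increasing_single_valued (R : realType) (I : set R)
    (f : R -> \bar R) :
  strictly_increasing_on I f -> single_valued_inverse_on I f.
Proof.
move=> incf d [x Ix fx]; exists x; split=> // y [Iy fy].
have [xy|yx|//] := ltgtP x y.
  by have := incf _ _ Ix Iy xy; rewrite fx fy ltxx.
by have := incf _ _ Iy Ix yx; rewrite fx fy ltxx.
Qed.

(** * The function [g]: attainment, positivity, monotonicity, and collapse for an untrusted unit *)

Section Detection.
Context (R : realType) (s : setup R) (M : {set 'I_2 * 'I_2}).
Hypotheses (hs : setup_ok s) (hchi : {within domain s, continuous (holevo s)}).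

(** Some leakage exceeds any number below the supremum; this makes the infimum defining [g] run over
    a nonempty set. *)
Lemma chi_range_attained x : chi_range s M x ->
  exists2 p, matching s M p & x <= holevo s p.
Proof.
move=> /andP[_ xmax].
have [|_ [p Fp <-] /ltW xp] := sup_gt _ xmax; last by exists p.
by exists (holevo s (p0 s)), (p0 s) => //; exact: matching_p0.
Qed.

(** Raising the threshold shrinks the set of admissible attacks; the value +oo on the empty set
    keeps this valid for all thresholds. *)
Lemma g_nondecreasing x y : x <= y -> (g s M x <= g s M y)%E.
Proof.
move=> xy; apply: ereal_inf_le_tmp => _ [p [Fp /= yp] <-].
by exists p => //; split=> //=; exact: le_trans yp.
Qed.

Lemma g_attained x : chi_range s M x ->
  exists q, [/\ matching s M q, x <= holevo s q,
    g s M x = (rel_entropy (Sigma0 s) (Sigma s q))%:E &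
    forall p, matching s M p -> x <= holevo s p ->
      rel_entropy (Sigma0 s) (Sigma s q) <= rel_entropy (Sigma0 s) (Sigma s p)].
Proof.
move=> /chi_range_attained[p Fp xp].
have sub := @matching_sub_domain R s M.
have [||||q [Fq xq qmin]] := @superlevel_argmin R _ (matching s M) (holevo s)
    (fun p => rel_entropy (Sigma0 s) (Sigma s p)) _ _ _ x.
- exact: matching_compact.
- exact: continuous_subspaceW sub hchi.
- exact: continuous_subspaceW sub (rel_entropy_Sigma_continuous hs).
- by exists p.
exists q; split=> //; apply/eqP; rewrite eq_le; apply/andP; split.
  by apply: ereal_inf_lbound; exists q.
by apply/ereal_infP => _ [p' [Fp' xp'] <-]; rewrite lee_fin qmin.
Qed.

Lemma g_gt0 x : chi_range s M x -> (0 < g s M x)%E.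
Proof.
move=> Ix; have [q [Fq xq -> _]] := g_attained Ix.
have pq : physical_channel q.
  exact: (physical_domain hs (matching_sub_domain Fq)).
rewrite lte_fin lt_neqAle rel_entropy_Sigma_ge0// andbT eq_sym.
apply/eqP => /(rel_entropy_Sigma_eq0 hs pq) qE.
by move: Ix; rewrite /chi_range /= /chi_ben -qE ltNge xq.
Qed.

Lemma g_strictly_increasing :
  (forall p, local_minimizer (matching s M)
     (fun q => rel_entropy (Sigma0 s) (Sigma s q)) p -> p = p0 s) ->
  strictly_increasing_on (chi_range s M) (g s M).
Proof.
move=> locmin x y Ix Iy xy.
rewrite lt_neqAle g_nondecreasing ?(ltW xy)// andbT; apply/eqP => gxy.
have [p [Fp xp gx pmin]] := g_attained Ix.
have [q [Fq yq gy _]] := g_attained Iy.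
have xq : x < holevo s q := lt_le_trans xy yq.
have qE : q = p0 s.
  apply: locmin; apply: superlevel_minimizer_local Fq xq _.
    exact: continuous_subspaceW (@matching_sub_domain R s M) hchi.
  (* Since g x = g y, the point [q] has the same divergence as the minimizer [p] for [x], and
     inherits its minimality. *)
  move=> r Fr xr; suff <- : rel_entropy (Sigma0 s) (Sigma s p) =
    rel_entropy (Sigma0 s) (Sigma s q) by exact: pmin.
  by apply: EFin_inj; rewrite -gx -gy.
by case/andP : Ix => xben _; move: xq; rewrite qE ltNge ltW.
Qed.

(** Over a channel with enough leakage, a recalibration that reproduces [Sigma0] gives divergence 0;
    positive definiteness of every observed covariance gives the lower bound. *)
Lemma g_untrusted_eq0 (Cal : Type) (obs : (R * R) * Cal -> 'M[R]_2) x :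
  untrusted_snu s obs ->
  (exists2 q, physical_channel q & x <= holevo s q) ->
  g_untrusted s obs x = 0%E.
Proof.
move=> [obs_pos obs0] [q pq xq]; have [r qr] := obs0 _ pq.
apply/eqP; rewrite eq_le; apply/andP; split.
  apply: ereal_inf_lbound; exists (q, r) => //.
  by rewrite qr rel_entropy_Sigma00.
apply/ereal_infP => _ [a [pa _] <-].
by rewrite lee_fin rel_entropy_Sigma0_ge0//; exact: obs_pos.
Qed.

End Detection.

Theorem theorem1 (R : realType) (s : setup R) (M : {set 'I_2 * 'I_2})
    (hs : setup_ok s)
    (hchi : {within domain s, continuous (holevo s)}) :
  (homeomorphism_onto_image (domain s) (Sigma s) ->
     [/\ forall x y, chi_range s M x -> chi_range s M y -> x <= y ->
           (g s M x <= g s M y)%E,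
         forall x, chi_range s M x -> (0 < g s M x)%E,
         trusted_correlation M ->
           strictly_increasing_on (chi_range s M) (g s M) /\
           single_valued_inverse_on (chi_range s M) (g s M)
       & (forall p, local_minimizer (matching s M)
                      (fun q => rel_entropy (Sigma0 s) (Sigma s q)) p
                    <-> p = p0 s) ->
           strictly_increasing_on (chi_range s M) (g s M) /\
           single_valued_inverse_on (chi_range s M) (g s M)])
  /\
  (forall (Cal : Type) (obs : (R * R) * Cal -> 'M[R]_2), untrusted_snu s obs ->
     (forall x, chi_range s M x -> g_untrusted s obs x = 0%E) /\
     (arbitrarily_large_leakage s -> forall x, g_untrusted s obs x = 0%E)).
Proof.
have general : (forall p, local_minimizer (matching s M)
      (fun q => rel_entropy (Sigma0 s) (Sigma s q)) p <-> p = p0 s) ->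
    strictly_increasing_on (chi_range s M) (g s M) /\
    single_valued_inverse_on (chi_range s M) (g s M).
  move=> locmin.
  have inc : strictly_increasing_on (chi_range s M) (g s M).
    by apply: g_strictly_increasing => // p /locmin.
  by split=> //; exact: strictly_increasing_single_valued.
split=> [_|Cal obs untr].
  split=> //.
  - by move=> x y _ _; exact: g_nondecreasing.
  - exact: g_gt0.
  - by move=> trM; apply: general => p; exact: trusted_local_minimizer.
(* For [x] in the range, a matching point with leakage at least [x] is itself a physical channel and
   serves as the attack. *)
split=> [x /(chi_range_attained hs)[p Fp xp]|large x].
  apply: g_untrusted_eq0 => //; exists p => //.
  exact: (physical_domain hs (matching_sub_domain Fp)).
by apply: g_untrusted_eq0 => //; exact: large.
Qed.
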